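(* Let $m\ge 1$, let $P_2=[u_1,u_2]$ be the path of order $2$ and let $F_m$ be the fan graph of order $m+1$ with vertices $v_0,v_1,\dots,v_m$, where $v_0$ is the hub. Then the harmonic centrality of any vertex $(u_i,v_j)$ of the Cartesian product $P_2\square F_m$ is $$\mathcal{H}_{P_2\square F_m}(u_i,v_j)=\begin{cases}\dfrac{3m+2}{2(2m+1)} & \text{for } i=1,2 \text{ and } j=0,\\[2mm] \dfrac{5m+14}{6(2m+1)} & \text{for } i=1,2 \text{ and } j=1,m,\\[2mm] \dfrac{5m+18}{6(2m+1)} & \text{for } i=1,2 \text{ and } 1<j<m.\end{cases}$$
   Context: All graphs are simple, undirected and finite. For a nontrivial graph $G$ of order $n$ (number of vertices) and a vertex $u$, the harmonic centrality of $u$ is $\mathcal{H}_G(u)=\frac{\mathcal{R}_G(u)}{n-1}$, where $\mathcal{R}_G(u)=\sum_{x\in V(G),\,x\ne u}\frac{1}{d(u,x)}$, $d$ is the shortest-path distance in $G$, and $\frac{1}{d(u,x)}=0$ if there is no path from $u$ to $x$. The fan $F_m$ has vertices $v_0,v_1,\dots,v_m$, where $v_1,\dots,v_m$ form a path with edges $v_kv_{k+1}$ ($1\le k<m$) and the hub $v_0$ is adjacent to each of $v_1,\dots,v_m$. The Cartesian product $G\square H$ has vertex set $V(G)\times V(H)$, with $(u,v)$ and $(u',v')$ adjacent iff either $u=u'$ and $v,v'$ are adjacent in $H$, or $v=v'$ and $u,u'$ are adjacent in $G$.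
   Formalization: The formula for j = 1, m is stated only for m ≥ 2: for m = 1 the product is the 4-cycle, where the centrality of (u_i, v_1) is 5/6 and not 19/18 as the formula would give. *)

(* Defs.v *)
From mathcomp Require Import all_boot all_order all_algebra.

Set Implicit Arguments.
Unset Strict Implicit.
Unset Printing Implicit Defensive.

Import GRing.Theory.

Record sgraph := SGraph {
  vertex :> finType;
  adj : rel vertex;
  adj_sym : symmetric adj;
  adj_irrefl : irreflexive adj }.

Section Distance.
Variable G : sgraph.

Definition walk_of_length (x y : G) (k : nat) : bool :=
  [exists p : k.-tuple G, path (@adj G) x p && (last x p == y)].

Lemma connect_walk (x y : G) :
  connect (@adj G) x y -> exists k, walk_of_length x y k.
Proof.
case/connectP => p xp ->; exists (size p).
by apply/existsP; exists (in_tuple p); rewrite xp eqxx.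
Qed.

(* None stands for infinite distance, i.e. for vertices in different
   components. *)
Definition dist (x y : G) : option nat :=
  match @idP (connect (@adj G) x y) with
  | ReflectT c => Some (ex_minn (connect_walk c))
  | ReflectF _ => None
  end.

Definition inv_dist (x y : G) : rat :=
  if dist x y is Some d then (d%:R^-1)%R else 0%R.

Definition reciprocal_distance_sum (u : G) : rat :=
  (\sum_(x : G | x != u) inv_dist u x)%R.

Definition harmonic_centrality (u : G) : rat :=
  (reciprocal_distance_sum u / (#|G|%:R - 1))%R.

End Distance.

Section PathGraph.
Variable n : nat.

Definition path_adj : rel 'I_n :=
  fun i j => (i.+1 == j :> nat) || (j.+1 == i :> nat).

Lemma path_adj_sym : symmetric path_adj.
Proof. by move=> i j; rewrite /path_adj orbC. Qed.

Lemma path_adj_irrefl : irreflexive path_adj.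
Proof. by move=> i; rewrite /path_adj orbb gtn_eqF. Qed.

(* The usual vertices u_1, ..., u_n are numbered from 0 here. *)
Definition path_graph : sgraph := SGraph path_adj_sym path_adj_irrefl.

End PathGraph.

Section Fan.
Variable m : nat.

(* Vertex 0 is the hub; vertices 1, ..., m form the path. *)
Definition fan_adj : rel 'I_m.+1 := fun i j =>
  [|| (i == 0 :> nat) && (0 < j), (j == 0 :> nat) && (0 < i),
      (0 < i) && (i.+1 == j :> nat) | (0 < j) && (j.+1 == i :> nat)].

Lemma fan_adj_sym : symmetric fan_adj.
Proof. by move=> i j; rewrite /fan_adj orbCA; do 2 congr orb; rewrite orbC. Qed.

Lemma fan_adj_irrefl : irreflexive fan_adj.
Proof.
by move=> i; rewrite /fan_adj [i.+1 == i]gtn_eqF // !andbF; case: (nat_of_ord i).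
Qed.

Definition fan : sgraph := SGraph fan_adj_sym fan_adj_irrefl.

End Fan.

Section CartesianProduct.
Variables G H : sgraph.

Definition cart_adj : rel (G * H)%type := fun x y =>
  ((x.1 == y.1) && adj x.2 y.2) || ((x.2 == y.2) && adj x.1 y.1).

Lemma cart_adj_sym : symmetric cart_adj.
Proof.
move=> x y; rewrite /cart_adj (eq_sym x.1) (eq_sym x.2).
by rewrite (adj_sym x.1) (adj_sym x.2).
Qed.

Lemma cart_adj_irrefl : irreflexive cart_adj.
Proof. by move=> x; rewrite /cart_adj !adj_irrefl !andbF. Qed.

Definition cart_prod : sgraph := SGraph cart_adj_sym cart_adj_irrefl.

End CartesianProduct.

(* Main.v *)
(* A function f on the vertices is the distance from u as soon as it vanishes
   exactly at u, grows by at most 1 along each edge, and decreases by exactly 1 along some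
   edge out of each vertex where it is positive.  Such functions add up in a
   cartesian product, and in the fan f takes only the values 0, 1, 2.  Hence the
   reciprocal distance sum of (u_i, v_j) depends only on m and the degree of v_j:
   it is 5 (m + 1) / 6 + 1 / 6 + 2 deg(v_j) / 3. *)
Require Import Defs.
From mathcomp Require Import all_boot all_order all_algebra.
From mathcomp Require Import zify ring.

Set Implicit Arguments.
Unset Strict Implicit.
Unset Printing Implicit Defensive.

Import GRing.Theory Num.Theory.

Definition distance_from (G : sgraph) (u : G) (f : G -> nat) : Prop :=
  [/\ forall x, (f x == 0) = (x == u),
      forall x y, adj x y -> f y <= (f x).+1
    & forall x, 0 < f x -> exists2 y, adj y x & f x = (f y).+1].

(** The growth bound makes every walk from [u] to [x] at least [f x] long; following descending
    neighbours back to [u] yields a walk of exactly that length. *)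
Lemma dist_distance_from (G : sgraph) (u : G) (f : G -> nat) :
  distance_from u f -> forall x, dist u x = Some (f x).
Proof.
move=> [f0 f_lip f_desc] x.
have fu : f u = 0 by apply/eqP; rewrite f0.
have f_path p y : path (@adj G) y p -> f (last y p) <= f y + size p.
  elim: p y => [|z p IHp] y /=; first by rewrite addn0.
  by case/andP=> /f_lip yz /IHp; lia.
have walk_le k : walk_of_length u x k -> f x <= k.
  by case/existsP=> p /andP[/f_path + /eqP <-]; rewrite fu size_tuple.
have walk_f : walk_of_length u x (f x).
  have [n] := ubnP (f x); elim: n x {walk_le} => // n IHn x fx.
  case: (posnP (f x)) => [fx0 | /f_desc[y yx fxy]].
    have /eqP -> : x == u by rewrite -f0 fx0.
    by rewrite fu; apply/existsP; exists [tuple]; rewrite /= eqxx.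
  have /existsP[p /andP[up /eqP lastp]] : walk_of_length u y (f y).
    by apply: IHn; lia.
  rewrite fxy; apply/existsP; exists [tuple of rcons p x].
  by rewrite /= rcons_path up lastp yx last_rcons eqxx.
have ux : connect (@adj G) u x.
  by case/existsP: walk_f => p /andP[up /eqP <-]; apply/connectP; exists p.
(* Only the boolean index of [reflect] is generalized, so that the dependent match reduces; [ux]
   rules out the [None] branch. *)
rewrite /dist; move: (@idP _); move: {2}(connect _ _) => b [c|] //.
case: ex_minnP => k /walk_le fxk /(_ _ walk_f) kfx.
by congr Some; apply/eqP; rewrite eqn_leq kfx.
Qed.

Lemma inv_dist_distance_from (G : sgraph) (u : G) (f : G -> nat) :
  distance_from u f -> forall x, inv_dist u x = ((f x)%:R^-1)%R.
Proof. by move=> uf x; rewrite /inv_dist (dist_distance_from uf). Qed.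

(* The summand at [x = u] may be included since [0^-1 = 0]. *)
Lemma reciprocal_distance_sumE (G : sgraph) (u : G) (f : G -> nat) :
  distance_from u f ->
  reciprocal_distance_sum u = (\sum_(x : G) (f x)%:R^-1)%R.
Proof.
move=> uf; have [f0 _ _] := uf.
rewrite [RHS](bigD1 u) //=; have /eqP -> : f u == 0 by rewrite f0.
by rewrite invr0 add0r; apply: eq_bigr => x _; exact: inv_dist_distance_from.
Qed.

Lemma distance_from_cart_prod (G H : sgraph) (u : G) (v : H)
    (f : G -> nat) (g : H -> nat) :
  distance_from u f -> distance_from v g ->
  @distance_from (cart_prod G H) (u, v) (fun x => f x.1 + g x.2).
Proof.
move=> [f0 f_lip f_desc] [g0 g_lip g_desc]; split=> [[x y]|[x y] [x' y']|[x y]] /=.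
- by rewrite addn_eq0 f0 g0 xpair_eqE.
- rewrite /cart_adj /=.
  by case/orP=> /andP[/eqP -> ]; [move/g_lip | move/f_lip]; lia.
(* Descend in the second coordinate while [g y] is positive, and in the first one afterwards. *)
- case: (posnP (g y)) => [gy0 | /g_desc[y' y'y gy] _].
    rewrite gy0 addn0 => /f_desc[x' x'x fx]; exists (x', y).
      by rewrite /= /cart_adj /= eqxx x'x orbT.
    by rewrite fx gy0 addn0.
  exists (x, y'); first by rewrite /= /cart_adj /= eqxx y'y.
  by rewrite gy addnS.
Qed.

Lemma distance_from_path2 (i : 'I_2) :
  @distance_from (path_graph 2) i (fun x => x != i).
Proof.
split=> [x|x y _|x] /=; first by case: (x == i).
  by case: (y != i).
rewrite lt0b => xi; exists i; last by rewrite xi eqxx.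
move: xi; rewrite /path_adj -val_eqE /=.
by case: x i => [[|[|?]] ?] [[|[|?]] ?].
Qed.

Definition fan_dist (m : nat) (j k : 'I_m.+1) : nat :=
  if k == j then 0 else if fan_adj j k then 1 else 2.

Lemma distance_from_fan (m : nat) (j : 'I_m.+1) :
  @distance_from (fan m) j (fan_dist j).
Proof.
rewrite /fan_dist; split=> [x|x y /= xy|x] /=.
- by case: (eqVneq x j) => // _; case: ifP.
- have [xj|_] := eqVneq x j; last by do !case: ifP.
  by rewrite -xj xy; case: ifP.
- case: (eqVneq x j) => // xj; case: ifP => [jx _|njx _].
    by exists j; rewrite ?eqxx.
  move: njx xj; rewrite /fan_adj -val_eqE /= => njx xj.
  (* Neither [x] nor [j] is the hub, as they are distinct and not adjacent; the hub is then a common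
     neighbour. *)
  exists ord0; first by rewrite /= /fan_adj /=; lia.
  by rewrite -val_eqE /=; do !case: ifP; lia.
Qed.

Definition fan_deg (m : nat) (j : 'I_m.+1) : nat := \sum_(k < m.+1) fan_adj j k.

Lemma sum_ord_eq (n a : nat) : \sum_(k < n) (k == a :> nat) = (a < n).
Proof.
have [an | na] := ltnP a n.
  rewrite (bigD1 (Ordinal an)) //= eqxx big1 ?addn0 // => k.
  by rewrite -val_eqE /= => /negPf ->.
by rewrite big1 // => k _; rewrite ltn_eqF // (leq_trans _ na).
Qed.

Lemma fan_deg_hub (m : nat) (j : 'I_m.+1) : j = 0 :> nat -> fan_deg j = m.
Proof.
move=> j0; rewrite /fan_deg big_ord_recl /fan_adj j0 /=.
by rewrite (eq_bigr (fun=> 1)) // sum1_card card_ord.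
Qed.

Lemma fan_deg_rim (m : nat) (j : 'I_m.+1) :
  0 < j -> fan_deg j = 1 + (j < m) + (1 < j).
Proof.
(* The neighbours are the hub, [j.+1] and [j.-1]. The factor [1 < j] keeps the hub from being
   counted twice when [j] is 1; for [j = m] the index [j.+1] is out of range and its indicator sums
   to 0. *)
move=> j0; transitivity
  (\sum_(k < m.+1) ((k == 0 :> nat) + (k == j.+1 :> nat)
    + (1 < j) * (k == j.-1 :> nat))).
  by apply: eq_bigr => k _; rewrite /fan_adj; lia.
rewrite !big_split -big_distrr /= !sum_ord_eq.
by have := ltn_ord j; lia.
Qed.

Local Open Scope ring_scope.

Lemma reciprocal_distance_sum_fan (m : nat) (i : 'I_2) (j : 'I_m.+1) :
  @reciprocal_distance_sum (cart_prod (path_graph 2) (fan m)) (i, j)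
  = (5 * m.+1 + 1)%:R / 6 + (fan_deg j)%:R * (2 / 3).
Proof.
rewrite (reciprocal_distance_sumE
  (distance_from_cart_prod (distance_from_path2 i) (distance_from_fan j))).
rewrite -(pair_bigA _ (fun x y => (((x != i) + fan_dist j y)%:R^-1 : rat))) /=.
rewrite exchange_big /=.
(* With [d = fan_dist j k], the two copies of [k] contribute [d^-1 + (1 + d)^-1], that is 1, 3/2 or
   5/6 for [d] equal to 0, 1 or 2. The base value is 5/6, with 1/6 more at [j] and 2/3 more at its
   neighbours. *)
transitivity (\sum_(k < m.+1)
  (5 / 6 + (k == j)%:R / 6 + (fan_adj j k)%:R * (2 / 3)) : rat).
  apply: eq_bigr => k _.
  transitivity ((fan_dist j k)%:R^-1 + (1 + fan_dist j k)%:R^-1 : rat).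
    case: i => [[|[|//]] ?]; rewrite !big_ord_recl big_ord0 -!val_eqE /= addr0 //.
    by rewrite addrC.
  rewrite /fan_dist; case: eqVneq => [->|_].
    by rewrite fan_adj_irrefl.
  by case: fan_adj.
rewrite !big_split /= -!big_distrl /= sumr_const card_ord.
rewrite -!natr_sum /fan_deg.
rewrite (eq_bigr _ (fun k _ => congr1 nat_of_bool (val_eqE k j))).
rewrite sum_ord_eq ltn_ord -[_ *+ m.+1]mulr_natr natrD natrM /=.
by field.
Qed.

Lemma harmonic_centrality_fan (m : nat) (i : 'I_2) (j : 'I_m.+1) :
  @harmonic_centrality (cart_prod (path_graph 2) (fan m)) (i, j)
  = (5 * m + 6 + 4 * fan_deg j)%:R / (6 * (2 * m + 1))%:R.
Proof.
rewrite /harmonic_centrality reciprocal_distance_sum_fan card_prod !card_ord.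
have m2 : (2 * m + 1)%:R != 0 :> rat by rewrite pnatr_eq0 addn1.
(* The product has [2 * m.+1] vertices, which gives the denominator [2 * m + 1]. *)
have -> : (2 * m.+1)%:R - 1 = (2 * m + 1)%:R :> rat.
  by rewrite mulnS addnC addn2 -addn1 natrD addrK addn1.
move: m2; rewrite ?(natrD, natrM, mulrS) => m2; field.
by rewrite m2.
Qed.

Local Close Scope ring_scope.

(** The degree of [j] is [m] at the hub, 2 at the ends of the rim and 3 inside it. The end case asks
    for [2 <= m]: for [m = 1] the only rim vertex has degree 1 and centrality 5/6, whereas the
    formula would give 19/18. *)
Theorem theorem3p3 (m : nat) (hm : 1 <= m) (i : 'I_2) (j : 'I_m.+1) :
  let HC := @harmonic_centrality (cart_prod (path_graph 2) (fan m)) (i, j) in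
  [/\ nat_of_ord j = 0 ->
        HC = ((3 * m + 2)%:R / (2 * (2 * m + 1))%:R)%R,
      2 <= m -> nat_of_ord j = 1 \/ nat_of_ord j = m ->
        HC = ((5 * m + 14)%:R / (6 * (2 * m + 1))%:R)%R
    & 1 < j < m ->
        HC = ((5 * m + 18)%:R / (6 * (2 * m + 1))%:R)%R].
Proof.
move=> HC; rewrite /HC harmonic_centrality_fan; split.
- move=> /fan_deg_hub ->.
  (* At the hub a factor 3 cancels from the fraction. *)
  have -> : 5 * m + 6 + 4 * m = 3 * (3 * m + 2) by lia.
  have -> : 6 * (2 * m + 1) = 3 * (2 * (2 * m + 1)) by lia.
  by rewrite !(natrM _ 3) -mulf_div divff ?mul1r.
- by move=> m2 j1m; rewrite fan_deg_rim; [congr (_%:R / _)%R | ]; lia.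
- by move=> j1m; rewrite fan_deg_rim; [congr (_%:R / _)%R | ]; lia.
Qed.
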